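(* Let $E$ be a simple, closed, densely defined, symmetric operator with infinite deficiency indices on a complex separable infinite dimensional Hilbert space $\mathfrak{X}$, let $Y\subseteq\mathfrak{X}$ be a closed infinite dimensional subspace, and let $\Omega\subseteq\mathbb{C}$ be a nonempty open set, symmetric about the real axis, consisting of $Y$-regular points of $E$. Write $\mathfrak{M}_\xi=\mathrm{rng}(E-\xi I)$. Let $\mathcal{H}_1,\mathcal{H}_2$ be the reproducing kernel Hilbert spaces and $\mathfrak{D}_1,\mathfrak{D}_2$ the operators constructed from $E$, $Y$, $\Omega$ as defined in the context. Suppose there exists at least one $\alpha\in\Omega\cap\mathbb{C}_+$ such that (i) $\dim(\mathfrak{M}_\alpha\cap\mathfrak{M}_\omega^\perp)<\infty$ and $\mathfrak{M}_\alpha+\mathfrak{M}_\omega^\perp$ is closed for all $\omega\in\Omega\cap\mathbb{C}_-$; (ii) $\dim(\mathfrak{M}_{\bar\alpha}\cap\mathfrak{M}_\omega^\perp)<\infty$ and $\mathfrak{M}_{\bar\alpha}+\mathfrak{M}_\omega^\perp$ is closed for all $\omega\in\Omega\cap\mathbb{C}_+$. Then: (1) the operator $E$ on $\mathfrak{X}$ is unitarily equivalent to the operator $\mathfrak{D}_1$ on the de Branges space $\mathcal{H}_1$; (2) the operator $E$ on $\mathfrak{X}$ is unitarily equivalent to the operator $\mathfrak{D}_2$ on the de Branges space $\mathcal{H}_2$.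
   Context: $\mathbb{C}_+,\mathbb{C}_-$ are the open upper and lower half planes. A symmetric operator $E$ is simple if it has no nonzero reducing subspace on which it is self-adjoint (equivalently $\bigcap_{\xi\in\mathbb{C}\setminus\mathbb{R}}\mathrm{rng}(E-\xi I)=\{0\}$). For a closed subspace $Y$ of $\mathfrak{X}$, a point $\xi\in\mathbb{C}$ is $Y$-regular for $E$ if $\mathfrak{M}_\xi$ is closed and $\mathfrak{X}=\mathfrak{M}_\xi\dotplus Y$ (direct sum). Every $Y$-regular point is a point of regular type of $E$, i.e. there is $c_\xi>0$ with $\|(E-\xi I)g\|\ge c_\xi\|g\|$ for all $g\in\mathcal{D}(E)$. For $\xi\in\Omega$, $P_Y(\xi)$ is the (bounded) projection onto $Y$ along $\mathfrak{M}_\xi$, and $\tau_Y(\xi)f=(E-\xi I)^{-1}(I-P_Y(\xi))f$; thus $f=(E-\xi I)\tau_Y(\xi)f+P_Y(\xi)f$. $\Pi_Y$ is the orthogonal projection of $\mathfrak{X}$ onto $Y$. For $f\in\mathfrak{X}$ put $f_Y(\xi)=P_Y(\xi)f$, $\xi\in\Omega$. $\mathcal{H}_1$ is the space of $\mathfrak{X}\oplus\mathfrak{X}$ valued functions $\begin{bmatrix}f_Y\\ \tilde f_Y\end{bmatrix}$ on $\Omega$, $f\in\mathfrak{X}$, where $\tilde f_Y(\xi)=\frac{1}{\pi i}\tau_Y(\xi)f$. $\mathcal{H}_2$ is the space of $Y\oplus Y$ valued functions $\begin{bmatrix}f_Y\\ \tilde f_Y\end{bmatrix}$ on $\Omega$,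 $f\in\mathfrak{X}$, where $\tilde f_Y(\xi)=\frac{1}{\pi i}\Pi_Y(\tau_Y(\xi)f)$. Both carry the inner product $\left\langle\begin{bmatrix}f_Y\\ \tilde f_Y\end{bmatrix},\begin{bmatrix}g_Y\\ \tilde g_Y\end{bmatrix}\right\rangle=2\langle f,g\rangle_{\mathfrak{X}}$ (well defined since $f\mapsto f_Y$ is injective). Let $\mathcal{N}_1=\mathcal{N}_2=\{f_Y:f\in\mathfrak{X}\}$ with inner product $\langle f_Y,g_Y\rangle=\langle f,g\rangle_{\mathfrak{X}}$. Let $T$ be multiplication by the independent variable on this space, $(Tf)(\lambda)=\lambda f(\lambda)$, with domain $\mathcal{D}(T)$ the set of those elements $f$ for which $\lambda\mapsto\lambda f(\lambda)$ again lies in the space. $R_\xi$ is the generalized backward shift, $(R_\xi g)(\lambda)=\frac{g(\lambda)-g(\xi)}{\lambda-\xi}$ for $\lambda\ne\xi$, $(R_\xi g)(\xi)=g'(\xi)$; it maps the space into itself for $\xi\in\Omega$. For $f_Y$ in this space define functions $Z_1f_Y$ and $Z_2f_Y$ on $\Omega$ by $\langle(Z_1f_Y)(\xi),l\rangle_{\mathfrak{X}}=\frac{1}{\pi i}\langle R_\xi f_Y,l_Y\rangle_{\mathcal{N}_1}$ and $\langle(Z_2f_Y)(\xi),l\rangle_{\mathfrak{X}}=\frac{1}{\pi i}\langle R_\xi f_Y,(\Pi_Yl)_Y\rangle_{\mathcal{N}_2}$ for all $\xi\in\Omega$, $l\in\mathfrak{X}$. One has $Z_kf_Y=\tilde f_Y$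 (with $\tilde f_Y$ as in $\mathcal{H}_k$), and $\mathfrak{D}_k$ ($k=1,2$) is the operator on $\mathcal{H}_k$ given by $\mathfrak{D}_k\begin{bmatrix}f_Y\\ Z_kf_Y\end{bmatrix}=\begin{bmatrix}Tf_Y\\ Z_kTf_Y\end{bmatrix}$ for all $f\in\mathfrak{X}$ with $f_Y\in\mathcal{D}(T)$. *)

(* Defs.v *)
From mathcomp Require Export all_boot all_order all_algebra sesquilinear.
From mathcomp Require Export all_classical all_reals all_analysis complex.
Export Order.TTheory GRing.Theory Num.Theory.
Export numFieldNormedType.Exports.

Set Implicit Arguments.
Unset Strict Implicit.
Unset Printing Implicit Defensive.

Global Open Scope classical_set_scope.
Global Open Scope ring_scope.

(* A possibly unbounded operator: [act] matters on [dom] only. *)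
Record operator (K : pzRingType) (V : lmodType K) :=
  Operator { dom : set V; act : V -> V }.

Section LinearAlgebra.
Context {K : pzRingType} {V : lmodType K}.

Definition subspace (S : set V) : Prop :=
  S 0 /\ forall (a : K) (x y : V), S x -> S y -> S (a *: x + y).

Definition linear_op (A : operator V) : Prop :=
  subspace (dom A) /\
  forall (a : K) (x y : V), dom A x -> dom A y ->
    act A (a *: x + y) = a *: act A x + act A y.

Definition finite_dim (S : set V) : Prop :=
  exists s : seq V,
    S = [set x | exists c : nat -> K, x = \sum_(i < size s) c i *: s`_i].

Definition sumset (S1 S2 : set V) : set V := [set x + y | x in S1 & y in S2].

Definition direct_sum_decomposition (S1 S2 : set V) : Prop :=
  sumset S1 S2 = setT /\ S1 `&` S2 = [set 0].

End LinearAlgebra.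

Section HilbertSpace.
Context {R : realType} {X : completeNormedModType R[i]}.

(* [ip] is linear in its first argument and induces the norm of [X], so that
   [X] with [ip] is a complex Hilbert space. *)
Definition hilbert_product (ip : {dot X for Num.conj}) : Prop :=
  forall x : X, ip x x = `|x| ^+ 2.

Variable ip : {dot X for Num.conj}.

Definition separable : Prop := exists D : set X, countable D /\ dense D.

Definition closed_subspace (S : set X) : Prop := subspace S /\ closed S.

Definition orth (S : set X) : set X := [set x | forall y, S y -> ip x y = 0].

Definition oproj (S : set X) (f : X) : X :=
  xget 0 [set y | S y /\ orth S (f - y)].

Variable E : operator X.

Definition closed_op : Prop := closed [set p : X * X | dom E p.1 /\ p.2 = act E p.1].

Definition symmetric_op : Prop := forall f g : X,
  dom E f -> dom E g -> ip (act E f) g = ip f (act E g).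

(* M_xi = rng(E - xi I) *)
Definition rngE (xi : R[i]) : set X := [set act E f - xi *: f | f in dom E].

Definition upper_half : set R[i] := [set z | 0 < complex.Im z].
Definition lower_half : set R[i] := [set z | complex.Im z < 0].

(* The deficiency indices are the dimensions of the orthogonal complements of
   the ranges of [E + iI] and [E - iI]. *)
Definition infinite_deficiency_indices : Prop :=
  ~ finite_dim (orth (rngE (- 'i))) /\ ~ finite_dim (orth (rngE 'i)).

(* [L] reduces [E] when the orthogonal projection onto [L] commutes with [E]:
   it maps the domain into itself and P E f = E P f there. *)
Definition reducing (L : set X) : Prop :=
  closed_subspace L /\
  forall f : X, dom E f ->
    dom E (oproj L f) /\ act E (oproj L f) = oproj L (act E f).

(* The part of [E] in [L], with domain D(E) `&` L, is densely defined in the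
   Hilbert space [L] and equals its adjoint there. *)
Definition selfadjoint_on (L : set X) : Prop :=
  L `<=` closure (dom E `&` L) /\
  forall g h : X, L g -> L h ->
    ((forall f, dom E f -> L f -> ip (act E f) g = ip f h) <->
     (dom E g /\ h = act E g)).

Definition simple_op : Prop := forall L : set X,
  reducing L -> selfadjoint_on L -> L = [set 0].

Variable Y : set X.

Definition regular_point (xi : R[i]) : Prop :=
  closed (rngE xi) /\ direct_sum_decomposition (rngE xi) Y.

(* For a [Y]-regular [xi]: the projection onto [Y] along the range of
   [E - xi I], and [(E - xi I)^-1 (I - P_Y(xi))]. *)
Definition projY (xi : R[i]) (f : X) : X :=
  xget 0 [set y | Y y /\ rngE xi (f - y)].

Definition tauY (xi : R[i]) (f : X) : X :=
  xget 0 [set g | dom E g /\ act E g - xi *: g = f - projY xi f].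

Variable Omega : set R[i].

(* A function on [Omega] is encoded as a function on the complex plane which
   vanishes outside [Omega]; pointwise operations are then those of the
   ambient function space. *)
Definition on_Omega (V : zmodType) (g : R[i] -> V) : R[i] -> V :=
  patch (fun=> 0) Omega g.

Definition fY (f : X) : R[i] -> X := on_Omega (fun xi => projY xi f).

Definition inv_pi_i : R[i] := ((pi : R)%:C%C * 'i)^-1.

Definition tilde1 (f : X) : R[i] -> X :=
  on_Omega (fun xi => inv_pi_i *: tauY xi f).

Definition tilde2 (f : X) : R[i] -> X :=
  on_Omega (fun xi => inv_pi_i *: oproj Y (tauY xi f)).

Definition column (g h : R[i] -> X) : R[i] -> (X * X)%type :=
  fun xi => (g xi, h xi).

Definition fst_entry (F : R[i] -> (X * X)%type) : R[i] -> X :=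
  fun xi => (F xi).1.

(* The form [(u f, u g) |-> c <f, g>] on the range of [u], for [u] injective. *)
Definition push_form (W : Type) (c : R[i]) (u : X -> W) (a b : W) : R[i] :=
  c * ip (xget 0 [set f | u f = a]) (xget 0 [set f | u f = b]).

Definition N_space : set (R[i] -> X) := range fY.
Definition N_form : (R[i] -> X) -> (R[i] -> X) -> R[i] := push_form 1 fY.

(* The elements of [H2_space] take their values in [Y * Y]. *)
Definition H1_space : set (R[i] -> (X * X)%type) :=
  range (fun f => column (fY f) (tilde1 f)).
Definition H1_form : (R[i] -> (X * X)%type) -> (R[i] -> (X * X)%type) -> R[i] :=
  push_form 2 (fun f => column (fY f) (tilde1 f)).

Definition H2_space : set (R[i] -> (X * X)%type) :=
  range (fun f => column (fY f) (tilde2 f)).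
Definition H2_form : (R[i] -> (X * X)%type) -> (R[i] -> (X * X)%type) -> R[i] :=
  push_form 2 (fun f => column (fY f) (tilde2 f)).

Definition T_op : operator (R[i] -> X) :=
  let mulvar (g : R[i] -> X) : R[i] -> X := fun lambda => lambda *: g lambda in
  Operator [set g | N_space g /\ N_space (mulvar g)] mulvar.

(* Generalized backward shift; the value at [xi] is the complex derivative. *)
Definition bshift (xi : R[i]) (g : R[i] -> X) : R[i] -> X :=
  on_Omega (fun lambda =>
    if lambda == xi then derive1 g xi
    else (lambda - xi)^-1 *: (g lambda - g xi)).

Definition Z1 (g : R[i] -> X) : R[i] -> X := on_Omega (fun xi =>
  xget 0 [set v | forall l : X,
    ip v l = inv_pi_i * N_form (bshift xi g) (fY l)]).

Definition Z2 (g : R[i] -> X) : R[i] -> X := on_Omega (fun xi =>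
  xget 0 [set v | forall l : X,
    ip v l = inv_pi_i * N_form (bshift xi g) (fY (oproj Y l))]).

(* [g; Z g] |-> [T g; Z (T g)]; the first entry determines an element of the
   domain. *)
Definition D_op (Z : (R[i] -> X) -> R[i] -> X) : operator (R[i] -> (X * X)%type) :=
  Operator [set column g (Z g) | g in dom T_op]
    (fun F => column (act T_op (fst_entry F)) (Z (act T_op (fst_entry F)))).

Definition D1_op := D_op Z1.
Definition D2_op := D_op Z2.

(* [E] on [X] is unitarily equivalent to [B] on the Hilbert space consisting of
   the subspace [H] of [W] with inner product [form]. *)
Definition unitarily_equivalent (W : lmodType R[i]) (H : set W)
    (form : W -> W -> R[i]) (B : operator W) : Prop :=
  exists U : {linear X -> W},
    [/\ range U = H,
        (forall f g : X, form (U f) (U g) = ip f g),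
        U @` dom E = dom B &
        forall f : X, dom E f -> act B (U f) = U (act E f)].

End HilbertSpace.

Arguments separable {R} X.

(* Main.v *)
Require Import Defs.
From HB Require Import structures.
From mathcomp Require Import ring lra.

Set Implicit Arguments.
Unset Strict Implicit.
Unset Printing Implicit Defensive.

(** Put [Omega' = Omega \ R] and let [L] be the intersection of the ranges of
    [E - xi I], [xi] in [Omega'].  If [(E - lambda I) h(lambda) = g - lambda f] for
    all [lambda] in [Omega'], the resolvent identity gives
    [(E - eta I) (h(lambda) - h(eta)) = (lambda - eta) (h(lambda) - f)], so that
    [h(lambda) - f] lies in [L].  For [f = 0] this says that [L] is invariant under
    all [(E - xi I)^-1], which makes [L] a reducing subspace on which [E] is
    self-adjoint; hence [L = 0] by simplicity, and [f |-> f_Y] is injective.  For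
    general [f] it says that [lambda f_Y = g_Y] forces [h(lambda) = f], so that the
    domain of [T] corresponds to that of [E].  The identity
    [P_Y(lambda) f - P_Y(xi) f = (lambda - xi) P_Y(lambda) tau_Y(xi) f] turns the
    backward shift into [tau_Y(xi)]; at [lambda = xi] it needs the continuity of
    [P_Y(lambda)] in [lambda], which the closed graph theorem provides.  Up to a
    factor [1 / sqrt 2], [f |-> (f_Y, Z_k f_Y)] is then the required unitary map. *)

(** * The real-valued norm and Zabreiko's lemma *)

Section RealNorm.
Variable R : realType.
Local Notation C := R[i].

(** Norms over [R[i]] are complex numbers. The real part of such a norm is an element of the totally
    ordered field [R], where [lra] and [nra] apply. *)
Definition rnorm (V : normedZmodType C) (x : V) : R := complex.Re `|x|.

Section Normed.
Variable V : normedZmodType C.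
Implicit Types x y : V.

Lemma rnormE x : `|x| = (rnorm x)%:C%C.
Proof.
have := normr_ge0 x; rewrite lecE /= => /andP[/eqP h _].
by rewrite /rnorm; case: `|x| h => a b /= ->.
Qed.

Lemma rnorm_ge0 x : 0 <= rnorm x.
Proof. by rewrite -ler0c -rnormE normr_ge0. Qed.

Lemma rnorm0 : rnorm (0 : V) = 0.
Proof. by rewrite /rnorm normr0. Qed.

Lemma rnorm0_eq0 x : rnorm x = 0 -> x = 0.
Proof. by move=> h; apply/eqP; rewrite -normr_eq0 rnormE h. Qed.

Lemma rnormN x : rnorm (- x) = rnorm x.
Proof. by rewrite /rnorm normrN. Qed.

Lemma rnormC x y : rnorm (x - y) = rnorm (y - x).
Proof. by rewrite /rnorm distrC. Qed.

Lemma ler_rnormD x y : rnorm (x + y) <= rnorm x + rnorm y.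
Proof. by rewrite -lecR rmorphD /= -!rnormE ler_normD. Qed.

Lemma ler_rnormB x y z : rnorm (x - z) <= rnorm (x - y) + rnorm (y - z).
Proof. by rewrite -[x - z](subrKA y) ler_rnormD. Qed.
End Normed.

Lemma rnormZ (V : normedModType C) (a : C) (x : V) :
  rnorm (a *: x) = rnorm a * rnorm x.
Proof. by apply: (@complexI R); rewrite rmorphM /= -!rnormE normrZ. Qed.

Lemma rnorm_real (r : R) : rnorm r%:C%C = `|r|.
Proof. by rewrite /rnorm normc_def /= expr0n addr0 sqrtr_sqr. Qed.

Lemma rnormZr (V : normedModType C) (r : R) (x : V) :
  rnorm (r%:C%C *: x) = `|r| * rnorm x.
Proof. by rewrite rnormZ rnorm_real. Qed.

Definition seq_limit (V : normedZmodType C) (u : nat -> V) (l : V) : Prop :=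
  forall e : R, 0 < e -> exists N, forall n, (N <= n)%N -> rnorm (u n - l) < e.

Lemma gt0_realC (e : C) : 0 < e -> exists2 r : R, 0 < r & e = r%:C%C.
Proof.
case: e => a b; rewrite ltcE /= => /andP[/eqP -> a0].
by exists a.
Qed.

Lemma closureP (V : normedModType C) (A : set V) (x : V) :
  closure A x <-> forall e : R, 0 < e -> exists2 a, A a & rnorm (x - a) < e.
Proof.
split=> [Ax e e0|Ax B /nbhs_ballP[e /= /gt0_realC[r r0 ->] eB]].
  have e0C : (0 : C) < e%:C%C by rewrite ltcR.
  have [a [Aa]] := Ax _ (nbhsx_ballx x _ e0C).
  by rewrite -ball_normE /ball_ /= rnormE ltcR; exists a.
have [a Aa ax] := Ax r r0; exists a; split=> //; apply: eB.
by rewrite -ball_normE /ball_ /= rnormE ltcR.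
Qed.

Lemma closedP (V : normedModType C) (A : set V) (x : V) : closed A ->
  (forall e : R, 0 < e -> exists2 a, A a & rnorm (x - a) < e) -> A x.
Proof. by move=> /closure_id A_cl xA; rewrite A_cl; apply/closureP. Qed.

Lemma complete_seq (X : completeNormedModType C) (u : nat -> X) :
  (forall e : R, 0 < e -> exists N, forall n, (N <= n)%N -> rnorm (u n - u N) < e) ->
  exists l, seq_limit u l.
Proof.
move=> cu.
have /cvg_ex[l ul] : cvg (u @ \oo).
  apply: cauchy_cvg; apply: cauchy_exP => e /gt0_realC[r r0 ->].
  have [N uN] := cu r r0.
  exists (u N), N => // n /= Nn.
  by rewrite -ball_normE /ball_ /= rnormE ltcR rnormC uN.
exists l => e e0.
have e0' : (0 : C) < e%:C%C by rewrite ltcR.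
have /cvgrPdist_lt/(_ _ e0')[N _ uN] := ul.
by exists N => n /uN /=; rewrite rnormE ltcR rnormC.
Qed.

Lemma expr_half_lt (e : R) : 0 < e -> exists N, forall n, (N <= n)%N -> 2^-1 ^+ n < e.
Proof.
move=> e0; exists (Num.truncn e^-1).+1 => n Nn.
rewrite exprVn -[e]invrK ltf_pV2 ?posrE ?invr_gt0 ?exprn_gt0 //.
apply: lt_le_trans (truncnS_gt _) _; rewrite -natrX ler_nat.
by apply: leq_trans Nn (ltnW (ltn_expl _ _)).
Qed.

(** * Zabreiko's lemma: boundedness of countably subadditive seminorms *)

Section Zabreiko.
Variables (X : completeNormedModType C) (N : X -> R).
Hypothesis N_D : forall x y, N (x + y) <= N x + N y.
Hypothesis N_Z : forall (r : R) x, N (r%:C%C *: x) = `|r| * N x.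
Hypothesis N_sigma : forall (u : nat -> X) x M,
  seq_limit (fun n => \sum_(k < n) u k) x ->
  (forall n, \sum_(k < n) N (u k) <= M) -> N x <= M.

(* Baire's theorem of the library is limited to real scalars, hence the explicit
   nested balls. *)
Lemma zabreiko_category : exists n x0 r, 0 < r /\
  forall x, rnorm (x - x0) < r -> forall e, 0 < e ->
    exists z, N z <= n%:R /\ rnorm (x - z) < e.
Proof.
apply: contrapT => notdense.
(* If no ball has [N z <= n] on a dense subset, every ball contains a smaller one on which [N]
   exceeds [n]. *)
have step (p : nat * (X * R)) : exists q : X * R, 0 < p.2.2 ->
    [/\ 0 < q.2, q.2 <= p.2.2 / 2, rnorm (q.1 - p.2.1) <= p.2.2 / 4 &
        forall z, rnorm (q.1 - z) < q.2 -> p.1%:R < N z].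
  case: p => n [x0 r] /=; have [r0|] := ltP 0 r; last by exists (x0, r).
  apply: contrapT => noq; apply: notdense; exists n, x0, (r / 4).
  split; first by rewrite divr_gt0.
  move=> x xx0 e e0; apply: contrapT => noz; apply: noq.
  exists (x, Num.min e (r / 2)) => _ /=; split.
  - by rewrite lt_min e0 divr_gt0.
  - by rewrite ge_min lexx orbT.
  - exact: ltW.
  - move=> z; rewrite lt_min => /andP[xz _]; rewrite ltNge; apply/negP => Nz.
    by apply: noz; exists z.
have [F FP] := choice step.
pose b := fix b n := if n is m.+1 then F (m, b m) else (0 : X, 1 : R).
have b_gt0 n : 0 < (b n).2.
  by elim: n => [|n IH] //=; have [] := FP (n, b n) IH.
have bS n := FP (n, b n) (b_gt0 n).
have b_le n : (b n).2 <= 2^-1 ^+ n.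
  elim: n => [|n IH]; first by rewrite expr0.
  have [_ /= h _ _] := bS n; rewrite exprS mulrC.
  by apply: le_trans h _; rewrite ler_pM2r.
(* A centre moves by at most a quarter of the old radius, and the radius at least halves; so each
   move is at most half the loss of radius, and the bounds telescope. *)
have b_dist m n : rnorm ((b (m + n)%N).1 - (b m).1) <= ((b m).2 - (b (m + n)%N).2) / 2.
  elim: n => [|n IH]; first by rewrite addn0 !subrr rnorm0 mul0r.
  have [_ /= h1 h2 _] := bS (m + n)%N; rewrite addnS /=.
  have := ler_rnormB (F ((m + n)%N, b (m + n)%N)).1 (b (m + n)%N).1 (b m).1.
  by lra.
have [l bl] : exists l, seq_limit (fun n => (b n).1) l.
  apply: complete_seq => e /expr_half_lt[k ek]; exists k => n /subnKC <-.
  have := b_dist k (n - k)%N; have := b_gt0 (k + (n - k))%N.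
  by have := b_le k; have := ek k (leqnn k); have := b_gt0 k; lra.
(* The limit [l] lies in every ball, in particular in the one on which [N] exceeds an integer
   already larger than [N l]. *)
have [_ _ _] := bS (Num.truncn (N l)).+1 => /(_ l).
set k := (Num.truncn (N l)).+2; rewrite -/(b k) => far.
have bk0 := b_gt0 k; have bk4 : 0 < (b k).2 / 4 by rewrite divr_gt0.
have [M /(_ (k + M)%N (leq_addl _ _)) lM] := bl _ bk4.
have := truncnS_gt (N l); rewrite ltNge => /negP; apply; apply/ltW/far.
have := ler_rnormB (b k).1 (b (k + M)%N).1 l.
have := b_dist k M; have := b_gt0 (k + M)%N.
by rewrite [X in _ -> _ -> _ <= X + _ -> _]rnormC; lra.
Qed.

(** Differences of points from the ball of [zabreiko_category] approximate every vector near 0, with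
    [N] at most [K]. Rescaling and approximating the remainder again and again writes a vector of
    norm below [r] as a series whose terms have [N] at most [K * 2^-1 ^+ k]; countable subadditivity
    bounds [N] by [K * 2] there. *)
Theorem zabreiko : exists2 c : R, 0 < c & forall x, N x <= c * rnorm x.
Proof.
have N_opp x : N (- x) = N x.
  by rewrite -scaleN1r -(rmorphN1 (real_complex R)) N_Z normrN1 mul1r.
have [n [x0 [r [r0 dense_r]]]] := zabreiko_category.
pose K : R := n%:R + n%:R.
have near0 x : rnorm x < r -> forall e, 0 < e ->
    exists z, N z <= K /\ rnorm (x - z) < e.
  move=> xr e e0; have e2 : 0 < e / 2 by rewrite divr_gt0.
  have [|z1 [Nz1 z1x]] := dense_r (x + x0) _ _ e2; first by rewrite addrK.
  have [|z2 [Nz2 z2x]] := dense_r x0 _ _ e2; first by rewrite subrr rnorm0.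
  exists (z1 - z2); split.
    by apply: le_trans (N_D _ _) _; rewrite N_opp lerD.
  have -> : x - (z1 - z2) = (x + x0 - z1) - (x0 - z2).
    by rewrite !opprB (addrAC x) -(addrA (x - z1)) (addrC x0) subrK addrAC addrA.
  by have := ler_rnormD (x + x0 - z1) (- (x0 - z2)); rewrite rnormN; lra.
have K0 : 0 <= K by rewrite addr_ge0.
have step (p : nat * X) : exists z, rnorm p.2 < r * 2^-1 ^+ p.1 ->
    N z <= K * 2^-1 ^+ p.1 /\ rnorm (p.2 - z) < r * 2^-1 ^+ p.1.+1.
  case: p => k x /=; set h : R := 2^-1 ^+ k.
  have h0 : 0 < h by rewrite exprn_gt0.
  have [xr|] := boolP (rnorm x < r * h); last by exists 0.
  have [||z [Nz xz]] := near0 (h^-1%:C%C *: x) _ (r / 2).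
  - by rewrite rnormZr gtr0_norm ?invr_gt0 // mulrC ltr_pdivrMr.
  - by rewrite divr_gt0.
  exists (h%:C%C *: z) => _; split.
    by rewrite N_Z gtr0_norm // mulrC ler_pM2r.
  have -> : x - h%:C%C *: z = h%:C%C *: (h^-1%:C%C *: x - z).
    by rewrite scalerBr scalerA -rmorphM mulfV ?gt_eqF // scale1r.
  rewrite rnormZr gtr0_norm // exprS -/h; move: xz; rewrite -(ltr_pM2l h0); lra.
have [G GP] := choice step.
have bounded x : rnorm x < r -> N x <= K * 2.
  move=> xr.
  pose y := fix y k := if k is m.+1 then y m - G (m, y m) else x.
  have y_lt k : rnorm (y k) < r * 2^-1 ^+ k.
    elim: k => [|k IH]; first by rewrite expr0 mulr1.
    by have [] := GP (k, y k) IH.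
  apply: (@N_sigma (fun k => G (k, y k))) => [e e0|m].
    have [M eM] := expr_half_lt (divr_gt0 e0 r0).
    exists M => m /eM; rewrite ltr_pdivlMr // mulrC.
    suff -> : \sum_(k < m) G (nat_of_ord k, y k) = x - y m.
      by rewrite addrC addKr rnormN; apply: lt_trans.
    elim: m => [|m IH]; first by rewrite big_ord0 /= subrr.
    by rewrite big_ord_recr /= IH opprB addrCA addrC addrA.
  (* The exact value of the geometric sum makes the induction go through. *)
  suff: \sum_(k < m) N (G (nat_of_ord k, y k)) <= K * (2 - 2 * 2^-1 ^+ m).
    move/le_trans; apply; rewrite ler_wpM2l // gerBl mulr_ge0 // exprn_ge0 //.
  elim: m => [|m IH]; first by rewrite big_ord0 expr0 mulr1 subrr mulr0.
  have [+ _] := GP (m, y m) (y_lt m); rewrite big_ord_recr /= exprS; lra.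
(* Rescaling [x] to norm [r / 2] gives the factor [4 * K / r]; the summand 1 keeps the constant
   positive when [K] is 0. *)
exists (4 * K / r + 1) => [|x].
  by rewrite ltr_wpDl // divr_ge0 ?mulr_ge0 // ltW.
have [x0'|xn0] := eqVneq (rnorm x) 0.
  have -> : x = 0 by exact: rnorm0_eq0.
  by rewrite rnorm0 mulr0 -(scale0r (0 : X)) -(rmorph0 (real_complex R)) N_Z normr0 mul0r.
have xgt0 : 0 < rnorm x by rewrite lt_def xn0 rnorm_ge0.
pose s := r / 2 / rnorm x.
have s0 : 0 < s by rewrite !divr_gt0.
have := bounded (s%:C%C *: x); rewrite N_Z rnormZr gtr0_norm // divfK //.
have /[swap]/[apply] : r / 2 < r by lra.
rewrite -ler_pdivlMl // => /le_trans; apply.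
rewrite [leRHS]mulrDl mul1r /s !invfM !invrK.
have -> : r^-1 * 2 * rnorm x * (K * 2) = 4 * K / r * rnorm x by field; rewrite gt_eqF.
by rewrite lerDl ltW.
Qed.
End Zabreiko.

End RealNorm.

(** * Orthogonal projections *)

Section Subspace.
Context {K : pzRingType} {V : lmodType K} {S : set V}.
Hypothesis S_sub : subspace S.

Lemma subspace0 : S 0. Proof. exact: S_sub.1. Qed.

Lemma subspaceZ a x : S x -> S (a *: x).
Proof. by move=> Sx; rewrite -[_ *: _]addr0; apply: S_sub.2 => //; exact: subspace0. Qed.

Lemma subspaceD x y : S x -> S y -> S (x + y).
Proof. by move=> Sx Sy; rewrite -[x]scale1r; apply: S_sub.2. Qed.

Lemma subspaceN x : S x -> S (- x).
Proof. by rewrite -scaleN1r; apply: subspaceZ. Qed.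

Lemma subspaceB x y : S x -> S y -> S (x - y).
Proof. by move=> Sx /subspaceN; apply: subspaceD. Qed.
End Subspace.

Section Hilbert.
Variables (R : realType) (X : completeNormedModType R[i]).
Local Notation C := R[i].
Local Notation nrm := (@rnorm R X).
Variable ip : {dot X for Num.conj}.
Hypothesis ip_hilbert : hilbert_product ip.

Lemma ipC x y : ip x y = (ip y x)^*.
Proof. by rewrite hermC expr0 mul1r. Qed.

Lemma ipDl x y z : ip (x + y) z = ip x z + ip y z.
Proof. exact: linearDl. Qed.

Lemma ipBl x y z : ip (x - y) z = ip x z - ip y z.
Proof. exact: linearBl. Qed.

Lemma ipBr x y z : ip z (x - y) = ip z x - ip z y.
Proof. exact: linearBr. Qed.

Lemma ipZl a x y : ip (a *: x) y = a * ip x y.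
Proof. exact: linearZl_LR. Qed.

Lemma ipZr a x y : ip x (a *: y) = a^* * ip x y.
Proof. exact: linearZr_LR. Qed.

Lemma ipNl x y : ip (- x) y = - ip x y.
Proof. exact: linearNl. Qed.

Lemma ip0l x : ip 0 x = 0.
Proof. exact: linear0l. Qed.

Lemma ipxx x : ip x x = (nrm x ^+ 2)%:C%C.
Proof. by rewrite ip_hilbert (rnormE x) rmorphXn. Qed.

Lemma ip_inj x : ip x x = 0 -> x = 0.
Proof. by move=> /eqP; rewrite dnorm_eq0 => /eqP. Qed.

Lemma ip_ext x y : (forall z, ip x z = ip y z) -> x = y.
Proof.
by move=> xy; apply/eqP; rewrite -subr_eq0; apply/eqP/ip_inj; rewrite ipBl xy subrr.
Qed.

Lemma parallelogram x y :
  nrm (x + y) ^+ 2 + nrm (x - y) ^+ 2 = 2 * (nrm x ^+ 2 + nrm y ^+ 2).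
Proof.
apply: (@complexI R); rewrite rmorphD /= -!ipxx dnormD dnormB.
rewrite mulr_natl rmorphMn /= (rmorphD (real_complex R)) /= -!ipxx mulr2n; ring.
Qed.

(** Subtracting from [w] its component [a *: z] along [z] lowers the squared norm by
    [|ip w z| ^+ 2 / ip z z], which minimality forces to vanish. *)
Lemma orth_of_min (S : set X) w : subspace S ->
  (forall z, S z -> nrm w <= nrm (w - z)) -> orth ip S w.
Proof.
move=> S_sub w_min z Sz; have [->|z0] := eqVneq z 0; first exact: linear0r.
have zz : 0 < ip z z by rewrite dnorm_gt0.
have zzN0 : ip z z != 0 by rewrite gt_eqF.
pose a := ip w z / ip z z.
have : ip w w <= ip (w - a *: z) (w - a *: z).
  rewrite !ipxx lecR ler_pXn2r ?nnegrE ?rnorm_ge0 //.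
  by apply: w_min; apply: subspaceZ.
have zzJ : (ip z z)^* = ip z z by rewrite -ipC.
rewrite dnormB dnormZ ipZr /a normCK !(rmorphM, fmorphV) /= !conjCK zzJ -subr_ge0.
set p := ip w z.
have -> : ip w w + p / ip z z * (p^* / ip z z) * ip z z -
   (p^* / ip z z * p + p / ip z z * p^*) - ip w w = - ((p * p^*) / ip z z) by field.
rewrite oppr_ge0 pmulr_lle0 ?invr_gt0 // -normCK => h.
by apply/eqP; rewrite -normr_eq0 -sqrf_eq0 eq_le h exprn_ge0.
Qed.

(** A minimizing sequence for the squared distance is Cauchy by the parallelogram law, since
    midpoints stay in [S]. Its limit attains the minimum, and [orth_of_min] applies. *)
Theorem projection_theorem (S : set X) x : closed_subspace S ->
  exists y, S y /\ orth ip S (x - y).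
Proof.
move=> [S_sub S_cl].
pose D := [set nrm (x - y) ^+ 2 | y in S].
have D_inf : has_inf D.
  split; first by exists (nrm (x - 0) ^+ 2), 0 => //; exact: subspace0.
  by exists 0 => _ [y _ <-]; rewrite sqr_ge0.
have D_lb y : S y -> inf D <= nrm (x - y) ^+ 2.
  by move=> Sy; apply: ge_inf; [exact: D_inf.2|exists y].
have approx n : exists y, S y /\ nrm (x - y) ^+ 2 < inf D + n.+1%:R^-1.
  have n0 : (0 : R) < n.+1%:R^-1 by rewrite invr_gt0.
  by have [_ [y Sy <-]] := inf_adherent n0 D_inf; exists y.
have [y /all_and2[Sy y_lt]] := choice approx.
have y_dist n m : nrm (y n - y m) ^+ 2 <= 2 * (n.+1%:R^-1 + m.+1%:R^-1).
  have := parallelogram (x - y n) (x - y m).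
  have -> : x - y n - (x - y m) = y m - y n by rewrite opprB addrC addrA subrK.
  have -> : x - y n + (x - y m) = 2%:C%C *: (x - 2^-1%:C%C *: (y n + y m)).
    rewrite scalerBr scalerA -rmorphM mulfV // scale1r rmorph_nat.
    by rewrite scaler_nat mulr2n addrACA opprD.
  rewrite rnormZr exprMn (rnormC (y m)) ger0_norm //.
  have := D_lb (2^-1%:C%C *: (y n + y m)).
  have /[swap]/[apply] : S (2^-1%:C%C *: (y n + y m)).
    by apply: subspaceZ => //; apply: subspaceD.
  have := y_lt n; have := y_lt m.
  move: (nrm (x - y m) ^+ 2) (nrm (x - y n) ^+ 2) (nrm (x - _) ^+ 2) (nrm (y n - y m) ^+ 2).
  by move: (inf D) (n.+1%:R^-1) (m.+1%:R^-1) => *; lra.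
have [l yl] : exists l, seq_limit y l.
  apply: complete_seq => e e0.
  pose N := Num.truncn (4 / e ^+ 2).
  have Ne : N.+1%:R^-1 < e ^+ 2 / 4.
    rewrite -[ltRHS]invrK ltf_pV2 ?posrE ?invr_gt0 ?divr_gt0 ?exprn_gt0 //.
    by rewrite invf_div truncnS_gt.
  exists N => n Nn; rewrite -(@ltr_pXn2r _ 2) ?nnegrE ?rnorm_ge0 ?ltW //.
  apply: le_lt_trans (y_dist _ _) _.
  have : n.+1%:R^-1 <= N.+1%:R^-1 :> R by rewrite lef_pV2 ?posrE // ler_nat.
  by move: Ne; move: (n.+1%:R^-1) (N.+1%:R^-1) => *; lra.
have Sl : S l.
  apply: closedP => // e /yl[N /(_ N (leqnn N)) h]; exists (y N) => //.
  by rewrite rnormC.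
have l_min z : S z -> nrm (x - l) <= nrm (x - z).
  move=> Sz; rewrite -(@ler_pXn2r _ 2) ?nnegrE ?rnorm_ge0 //.
  apply: le_trans (D_lb _ Sz); apply/ler_addgt0Pr => e e0.
  pose a := nrm (x - l).
  have a0 : 0 <= a := rnorm_ge0 _.
  (* Chosen so that [2 * a * b <= e / 4], which bounds the loss in passing from [a <= p + q] with
     [q < b] to squares. *)
  pose b := Num.min 1 (e / (4 * (2 * a + 1))).
  have c0 : 0 < 4 * (2 * a + 1) by lra.
  have b0 : 0 < b by rewrite lt_min ltr01 divr_gt0.
  have b1 : b <= 1 by rewrite ge_min lexx.
  have be : b * (4 * (2 * a + 1)) <= e by rewrite -ler_pdivlMr // ge_min lexx orbT.
  have [N lN] := yl b b0.
  have Ne : (Num.truncn (4 / e)).+1%:R^-1 < e / 4.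
    rewrite -[ltRHS]invrK ltf_pV2 ?posrE ?invr_gt0 ?divr_gt0 //.
    by rewrite invf_div truncnS_gt.
  set n := maxn N (Num.truncn (4 / e)).
  have ne : n.+1%:R^-1 < e / 4.
    by apply: le_lt_trans Ne; rewrite lef_pV2 ?posrE // ler_nat ltnS leq_maxr.
  have := lN n (leq_maxl _ _); have := ler_rnormB x (y n) l; rewrite -/a.
  have := y_lt n; move: ne; move: (n.+1%:R^-1) => t ne; set p := nrm (x - y n); set q := nrm (y n - l) => h1 h2 h3.
  have p0 : 0 <= p := rnorm_ge0 _.
  have : a ^+ 2 <= p ^+ 2 + 2 * a * b.
    have [ab|/ltW ab] := leP a b; first nra.
    have : (a - b) ^+ 2 <= p ^+ 2 by rewrite ler_pXn2r ?nnegrE //; lra.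
    nra.
  nra.
exists l; split=> //; apply: orth_of_min => // z Sz.
by rewrite -addrA -opprD; apply: l_min; apply: subspaceD.
Qed.

Section Projection.
Variable S : set X.
Hypothesis S_cl : closed_subspace S.

Lemma oproj_in f : S (oproj ip S f).
Proof. by have /(xgetPex 0)[] := projection_theorem f S_cl. Qed.

Lemma oproj_orth f : orth ip S (f - oproj ip S f).
Proof. by have /(xgetPex 0)[] := projection_theorem f S_cl. Qed.

Lemma oprojE f y : S y -> orth ip S (f - y) -> oproj ip S f = y.
Proof.
move=> Sy fy; apply/eqP; rewrite -subr_eq0; apply/eqP/ip_inj.
set z := oproj ip S f - y.
have Sz : S z by apply: subspaceB (oproj_in f) Sy; exact: S_cl.1.
have {1}-> : z = (f - y) - (f - oproj ip S f).
  by rewrite opprB addrC addrA subrK.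
by rewrite ipBl fy // oproj_orth // subrr.
Qed.

Lemma oproj_linear : linear (oproj ip S).
Proof.
move=> a f g; apply: oprojE => [|h Sh].
  by apply: S_cl.1.2; exact: oproj_in.
rewrite opprD addrACA -scalerBr ipDl ipZl !oproj_orth //.
by rewrite mulr0 addr0.
Qed.

Lemma oproj_selfadjoint f g : ip (oproj ip S f) g = ip f (oproj ip S g).
Proof.
have h u v : ip (oproj ip S u) v = ip (oproj ip S u) (oproj ip S v).
  apply/eqP; rewrite -subr_eq0 -ipBr ipC oproj_orth ?rmorph0 //.
  exact: oproj_in.
by rewrite h ipC -h -ipC.
Qed.
End Projection.

Lemma closure_subspace (S : set X) : subspace S -> subspace (closure S).
Proof.
move=> S_sub; split; first by apply: subset_closure; exact: subspace0.
move=> a x y /closureP xS /closureP yS; apply/closureP => e e0.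
have a0 : 0 < rnorm a + 1 by rewrite ltr_wpDl // rnorm_ge0.
have e2 : 0 < e / 2 by rewrite divr_gt0.
have [x' Sx' xx'] := xS _ (divr_gt0 e2 a0).
have [y' Sy' yy'] := yS _ e2.
exists (a *: x' + y'); first exact: S_sub.2.
rewrite opprD addrACA -scalerBr.
move: xx'; rewrite ltr_pdivlMr // => xx'.
have := ler_rnormD (a *: (x - x')) (y - y'); rewrite rnormZ.
have := rnorm_ge0 (x - x'); nra.
Qed.

(** The component of a vector of [L] orthogonal to the closure of [S] remains in [L], so it vanishes
    by assumption. *)
Lemma sub_closure_of_orth (S L : set X) : subspace S -> closed_subspace L ->
  S `<=` L -> (forall h, L h -> orth ip S h -> h = 0) -> L `<=` closure S.
Proof.
move=> S_sub L_cl SL L_orth x Lx.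
have cS_cl : closed_subspace (closure S).
  by split; [exact: closure_subspace|exact: closed_closure].
have cSL : closure S `<=` L by rewrite (closure_id L).1; [exact: closureS|exact: L_cl.2].
have px := oproj_in cS_cl x.
suff /eqP : x - oproj ip (closure S) x = 0 by rewrite subr_eq0 => /eqP ->.
apply: L_orth => [|y Sy]; first by apply: subspaceB L_cl.1 _ _ Lx _; exact: cSL.
by apply: (oproj_orth cS_cl); exact: subset_closure.
Qed.
End Hilbert.

(** * Simple symmetric operators *)

Section Shift.
Context {K : comPzRingType} {V : lmodType K} (E : operator V).

Definition eshift (xi : K) (h : V) : V := act E h - xi *: h.

Lemma eshift_shift xi eta h : eshift eta h = eshift xi h + (xi - eta) *: h.
Proof. by rewrite /eshift scalerBl addrA subrK. Qed.

Hypothesis E_linear : linear_op E.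
Let E_dom : subspace (dom E) := E_linear.1.

Lemma eshiftP xi a x y : dom E x -> dom E y ->
  eshift xi (a *: x + y) = a *: eshift xi x + eshift xi y.
Proof.
move=> Ex Ey; rewrite /eshift E_linear.2 //.
by rewrite scalerDr opprD addrACA scalerBr !scalerA (mulrC a).
Qed.

Lemma eshiftB xi x y : dom E x -> dom E y ->
  eshift xi (x - y) = eshift xi x - eshift xi y.
Proof.
by move=> Ex Ey; rewrite addrC -scaleN1r eshiftP // scaleN1r addrC.
Qed.

Lemma eshift0 xi : eshift xi 0 = 0.
Proof. by have := eshiftB xi (subspace0 E_dom) (subspace0 E_dom); rewrite !subrr. Qed.

Lemma eshiftZ xi a x : dom E x -> eshift xi (a *: x) = a *: eshift xi x.
Proof.
move=> Ex; have := eshiftP xi a Ex (subspace0 E_dom).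
by rewrite eshift0 !addr0.
Qed.

End Shift.

Section SymmetricOperator.
Variables (R : realType) (X : completeNormedModType R[i]).
Local Notation C := R[i].
Local Notation nrm := (@rnorm R X).
Variables (ip : {dot X for Num.conj}) (E : operator X).
Hypotheses (ip_hilbert : hilbert_product ip) (E_linear : linear_op E)
  (E_symmetric : symmetric_op ip E).

(* [ring] does not handle modules: pair both sides with an arbitrary vector. *)
Local Ltac vector_ring :=
  apply: (ip_ext (ip := ip)) => ?; rewrite !(ipDl, ipBl, ipZl, ipNl, ip0l); ring.

Let E_dom : subspace (dom E) := E_linear.1.

Lemma rngE_subspace xi : subspace (rngE E xi).
Proof.
split; first by exists 0; [exact: subspace0|exact: eshift0].
move=> a _ _ [x Ex <-] [y Ey <-]; exists (a *: x + y); first exact: E_dom.2.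
exact: eshiftP.
Qed.

Lemma eshift_ip xi f g : dom E f -> dom E g ->
  ip (eshift E xi f) g = ip f (eshift E xi^* g).
Proof. by move=> Ef Eg; rewrite ipBl ipBr E_symmetric // ipZl ipZr conjCK. Qed.

(** With [A] the shift by the real part, [ip A h] is real by symmetry. The cross terms with the
    imaginary multiple of [h] therefore cancel, and the squared norm is that of [A] plus that of
    [c *: h]. *)
Lemma eshift_bound xi h : dom E h -> `|complex.Im xi| * nrm h <= nrm (eshift E xi h).
Proof.
case: xi => a b Eh /=; set r := Complex a 0; set c := Complex 0 b.
have xiE : Complex a b = r + c by apply/eqP; rewrite eq_complex /= addr0 add0r !eqxx.
have rJ : r^* = r by apply/eqP; rewrite eq_complex /= oppr0 !eqxx.
have cJ : c^* = - c by apply/eqP; rewrite eq_complex /= oppr0 !eqxx.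
have normc : rnorm c = `|b|.
  by rewrite /rnorm normc_def /= expr0n add0r sqrtr_sqr.
pose A := eshift E r h.
have AJ : (ip A h)^* = ip A h by rewrite -ipC eshift_ip // rJ.
have -> : eshift E (Complex a b) h = A - c *: h by rewrite /A /eshift xiE; vector_ring.
rewrite -(@ler_pXn2r _ 2) ?nnegrE ?mulr_ge0 ?rnorm_ge0 //.
have cross : ip A (c *: h) + (ip A (c *: h))^* = 0.
  by rewrite ipZr cJ mulNr rmorphN rmorphM /= cJ AJ mulNr opprK addNr.
rewrite -lecR -normc -rnormZ -!(ipxx ip_hilbert) dnormB cross subr0.
by rewrite lerDr dnorm_ge0.
Qed.

(** * The intersection of the ranges as a reducing subspace *)

Section Reducing.
Variable Omega : set C.
Hypotheses (Omega_open : open (Omega : set C^o))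
  (Omega_symmetric : forall xi, Omega xi -> Omega xi^*)
  (Omega_closed : forall xi, Omega xi -> closed (rngE E xi)).

(** At real points [eshift_bound] is void; injectivity there is deduced afterwards, in
    [eshift_injective]. *)
Definition nonreal_part : set C := [set xi | Omega xi /\ complex.Im xi != 0].
Local Notation Omega' := nonreal_part.

(* [E] is self-adjoint on this subspace, which is thus [0] when [E] is simple. *)
Definition common_range : set X := [set f | forall xi, Omega' xi -> rngE E xi f].
Local Notation L := common_range.

Lemma nonreal_part_conj xi : Omega' xi -> Omega' xi^*.
Proof.
case: xi => a b [Oxi b0]; split; first exact: Omega_symmetric.
by rewrite /= oppr_eq0.
Qed.

(** A horizontal displacement preserves the imaginary part, hence the constant in [eshift_bound]. *)
Lemma open_real_shift xi : Omega xi ->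
  exists2 d : R, 0 < d & forall t : R, `|t| < d -> Omega (xi + t%:C%C).
Proof.
move=> Oxi; have : nbhs (xi : C^o) Omega by apply: open_nbhs_nbhs; split.
move=> /nbhs_ballP[e /= /gt0_realC[d d0 ->] dO]; exists d => // t td.
apply: dO; rewrite -ball_normE /ball_ /= opprD addrA subrr add0r normrN.
by rewrite rnormE ltcR rnorm_real.
Qed.

Lemma common_range_closed : closed_subspace L.
Proof.
split; first split.
- by move=> xi _; exact: subspace0 (rngE_subspace xi).
- by move=> a x y Lx Ly xi Oxi; apply: (rngE_subspace xi).2; [exact: Lx|exact: Ly].
- rewrite /common_range => f Lf xi Oxi; apply: closedP => [|e e0].
    exact: Omega_closed Oxi.1.
  by have /closureP/(_ e e0)[a La fa] := Lf; exists a => //; exact: La.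
Qed.

(* The resolvent identity puts [h lambda - f] in the range of [E - eta I] for
   [eta <> lambda]; that range is closed, and [lambda] is approached along a
   horizontal line, on which [eshift_bound] is uniform. *)
Lemma resolvent_common_range (f g : X) (h : C -> X) :
  (forall lambda, Omega' lambda ->
    dom E (h lambda) /\ eshift E lambda (h lambda) = g - lambda *: f) ->
  forall lambda, Omega' lambda -> L (h lambda - f).
Proof.
move=> hP.
have diff lambda eta : Omega' lambda -> Omega' eta ->
    eshift E eta (h lambda - h eta) = (lambda - eta) *: (h lambda - f).
  move=> /hP[hl El] /hP[he Ee].
  rewrite eshiftB // Ee (eshift_shift E lambda) El; vector_ring.
have offdiag lambda eta : Omega' lambda -> Omega' eta -> lambda != eta ->
    rngE E eta (h lambda - f).
  move=> Ol Oe le.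
  have d0 : lambda - eta != 0 by rewrite subr_eq0.
  have Ed := subspaceB E_dom (hP _ Ol).1 (hP _ Oe).1.
  exists ((lambda - eta)^-1 *: (h lambda - h eta)); first exact: subspaceZ.
  by rewrite -/(eshift E _ _) eshiftZ // diff // scalerA mulVf // scale1r.
move=> lambda Ol eta Oe; have [<-|] := eqVneq lambda eta; last exact: offdiag.
apply: closedP => [|e e0]; first exact: Omega_closed Ol.1.
have [d d0 dO] := open_real_shift Ol.1.
set b := `|complex.Im lambda|; set K := nrm (h lambda - f).
have b0 : 0 < b by rewrite normr_gt0 Ol.2.
have K0 : 0 <= K := rnorm_ge0 _.
(* The first bound keeps [mu] in [Omega]. The second yields [t * K < e * b], so that [h mu] is
   within [e] of [h lambda]; the summand 1 provides strictness and a nonzero denominator. *)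
pose t := Num.min (d / 2) (e * b / (K + 1)).
have t0 : 0 < t by rewrite lt_min !divr_gt0 ?mulr_gt0 // ltr_wpDl.
have td : `|t| < d by rewrite gtr0_norm // gt_min; apply/orP; left; lra.
have tK : t * (K + 1) <= e * b.
  by rewrite -ler_pdivlMr ?ltr_wpDl // ge_min lexx orbT.
pose mu := lambda + t%:C%C.
have Im_mu : complex.Im mu = complex.Im lambda.
  by rewrite /mu; case: (lambda) => x y /=; rewrite addr0.
have Omu : Omega' mu by split; [exact: dO|rewrite Im_mu Ol.2].
exists (h mu - f).
  apply: offdiag => //; rewrite -subr_eq0 /mu addrC addKr.
  by rewrite eq_complex /= gt_eqF.
rewrite opprB addrA subrK.
have := eshift_bound mu (subspaceB E_dom (hP _ Ol).1 (hP _ Omu).1).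
rewrite diff // Im_mu -/b /mu opprD addrA subrr add0r -rmorphN rnormZr normrN.
rewrite gtr0_norm // -/K => h1.
by rewrite -(ltr_pM2l b0); nra.
Qed.

(** This is [resolvent_common_range] with right-hand side [f - lambda *: 0]: the resolvents leave
    [L] invariant. *)
Lemma common_range_resolvent xi f : Omega' xi -> L f ->
  exists u, [/\ dom E u, L u & eshift E xi u = f].
Proof.
move=> Oxi Lf.
have inv lambda : exists u, Omega' lambda -> dom E u /\ eshift E lambda u = f - lambda *: 0.
  have [/Lf[u Eu uf]|nO] := pselect (Omega' lambda); last by exists 0.
  by exists u; rewrite scaler0 subr0.
have [h hP] := choice inv.
have := resolvent_common_range hP Oxi; rewrite subr0.
by have [Eh hE] := hP _ Oxi; exists (h xi); rewrite hE scaler0 subr0.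
Qed.

Section Point.
Variable xi : C.
Hypothesis Oxi : Omega' xi.
Let Oxi' := nonreal_part_conj Oxi.

Lemma common_range_reducing : reducing ip E L.
Proof.
split=> [|f Ef]; first exact: common_range_closed.
have [Lin Lor] := (oproj_in ip_hilbert common_range_closed,
                   oproj_orth ip_hilbert common_range_closed).
have [u [Eu Lu uE]] := common_range_resolvent Oxi (Lin (eshift E xi f)).
have PfE : oproj ip L f = u.
  apply: (oprojE ip_hilbert common_range_closed) => // y Ly.
  have [v [Ev Lv <-]] := common_range_resolvent Oxi' Ly.
  by rewrite -eshift_ip ?eshiftB ?uE ?Lor //; exact: subspaceB.
rewrite PfE; split=> //; rewrite -[act E u](subrK (xi *: u)) -/(eshift E xi u) uE.
have -> : eshift E xi f = - xi *: f + act E f by rewrite scaleNr addrC.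
rewrite (oproj_linear ip_hilbert common_range_closed) PfE.
by rewrite scaleNr addrAC addNr add0r.
Qed.

(** The classical criterion: on [L] both [E - xi] and [E - xi^*] are onto. This gives density of the
    domain as well as the reverse inclusion for the adjoint. *)
Lemma common_range_selfadjoint : selfadjoint_on ip E L.
Proof.
have S_sub : subspace (dom E `&` L).
  have [L_sub _] := common_range_closed.
  split; first by split; exact: subspace0.
  by move=> a x y [Ex Lx] [Ey Ly]; split; [exact: E_dom.2|exact: L_sub.2].
split.
  apply: (sub_closure_of_orth ip_hilbert S_sub common_range_closed) => [x []//|h Lh h_orth].
  have [u [Eu Lu uE]] := common_range_resolvent Oxi' Lh.
  have [v [Ev Lv vE]] := common_range_resolvent Oxi Lu.
  suff u0 : u = 0 by rewrite -uE u0 eshift0.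
  by apply: (ip_inj (ip := ip)); rewrite -{2}vE -[xi]conjCK -eshift_ip // uE h_orth.
move=> g h Lg Lh; split=> [gh|[Eg ->] f Ef Lf]; last exact: E_symmetric.
have [L_sub _] := common_range_closed.
have [u [Eu Lu uE]] := common_range_resolvent Oxi (subspaceB L_sub Lh (subspaceZ L_sub xi Lg)).
suff guE : g = u.
  rewrite guE; split=> //; rewrite -[act E u](subrK (xi *: u)) -/(eshift E xi u) uE.
  by rewrite -guE subrK.
apply/eqP; rewrite -subr_eq0; apply/eqP/(ip_inj (ip := ip)).
have [v [Ev Lv vE]] := common_range_resolvent Oxi' (subspaceB L_sub Lg Lu).
rewrite -{1}vE ipBr (eshift_ip _ Ev Eu) conjCK uE.
by rewrite /eshift ipBl ipZl ipBr ipZr gh // subrr.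
Qed.

End Point.

Hypothesis E_simple : simple_op ip E.
Hypothesis Omega'_nonempty : Omega' !=set0.

Lemma common_range_eq0 f : L f -> f = 0.
Proof.
have [xi Oxi] := Omega'_nonempty.
by rewrite (E_simple (common_range_reducing Oxi) (common_range_selfadjoint Oxi)).
Qed.

(** At a nonreal point this is [eshift_bound]. An eigenvector for a real [xi] satisfies
    [(E - eta) h = (xi - eta) *: h], so it lies in all the ranges defining [L]. *)
Lemma eshift_injective xi h : dom E h -> eshift E xi h = 0 -> h = 0.
Proof.
move=> Eh h0; have [xi_real|xi_nonreal] := eqVneq (complex.Im xi) 0.
  apply: common_range_eq0 => eta [_ eta_nonreal].
  have d0 : xi - eta != 0.
    by rewrite subr_eq0; apply: contra eta_nonreal => /eqP <-; exact/eqP.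
  exists ((xi - eta)^-1 *: h); first exact: subspaceZ.
  rewrite -/(eshift E _ _) eshiftZ // (eshift_shift E xi) h0 add0r.
  by rewrite scalerA mulVf // scale1r.
apply: rnorm0_eq0; apply/eqP; rewrite eq_le rnorm_ge0 andbT.
by have := eshift_bound xi Eh; rewrite h0 rnorm0 pmulr_rle0 // normr_gt0.
Qed.

End Reducing.
End SymmetricOperator.

(** * Regular points *)

Lemma summable_limit (R : realType) (X : completeNormedModType R[i]) (a : nat -> X) (M : R) :
  (forall n, \sum_(k < n) rnorm (a k) <= M) ->
  exists l, seq_limit (fun n => \sum_(k < n) a k) l.
Proof.
move=> aM; pose s n := \sum_(k < n) rnorm (a k).
have s_sup : has_sup (range s).
  by split; [exists (s 0%N), 0%N|exists M => _ [n _ <-]; exact: aM].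
apply: complete_seq => e e0.
have [_ [N _ <-] sN] := sup_adherent e0 s_sup.
exists N => n /subnKC <-; move: (n - N)%N => m.
have sup_s : s (N + m)%N <= sup (range s).
  by apply: ub_le_sup; [exact: s_sup.2|exists (N + m)%N].
have : rnorm (\sum_(k < N + m) a k - \sum_(k < N) a k) <= s (N + m)%N - s N.
  elim: m {sup_s} => [|m IH]; first by rewrite addn0 !subrr rnorm0.
  rewrite addnS /s !big_ord_recr /= -/(s _) -/(s _) addrAC [leRHS]addrAC.
  by apply: le_trans (ler_rnormD _ _) _; rewrite lerD2r.
lra.
Qed.

Lemma closed_opP (R : realType) (X : completeNormedModType R[i]) (E : operator X) x v :
  closed_op E ->
  (forall e : R, 0 < e ->
     exists f, [/\ dom E f, rnorm (x - f) < e & rnorm (v - act E f) < e]) ->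
  dom E x /\ v = act E x.
Proof.
move=> E_closed near_graph.
apply: (@closedP R (X * X)%type _ (x, v) E_closed) => e /near_graph[f [Ef xf vf]].
exists (f, act E f) => //.
rewrite -ltcR -rnormE prod_normE /= !rnormE.
by rewrite /Order.max; case: ifP => _; rewrite ltcR.
Qed.

Section Regular.
Variables (R : realType) (X : completeNormedModType R[i]).
Local Notation C := R[i].
Local Notation nrm := (@rnorm R X).
Variables (E : operator X) (Y : set X).
Hypotheses (E_linear : linear_op E) (E_closed : closed_op E)
  (Y_closed : closed_subspace Y).

Let E_dom : subspace (dom E) := E_linear.1.
Let Y_sub : subspace Y := Y_closed.1.

Section Point.
Variable xi : C.
Hypotheses (xi_regular : regular_point E Y xi)
  (xi_inj : forall h, dom E h -> eshift E xi h = 0 -> h = 0).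

Lemma projY_spec f : Y (projY E Y xi f) /\ rngE E xi (f - projY E Y xi f).
Proof.
apply: (xgetPex 0 (P := [set y | Y y /\ rngE E xi (f - y)])).
have : [set: X] f by [].
by rewrite -xi_regular.2.1 => -[x Ex [y Yy <-]]; exists y; split=> //; rewrite addrK.
Qed.

Lemma tauY_spec f : dom E (tauY E Y xi f) /\
  eshift E xi (tauY E Y xi f) = f - projY E Y xi f.
Proof.
apply: (xgetPex 0 (P := [set g | dom E g /\ act E g - xi *: g = f - projY E Y xi f])).
by have [_ [h Eh hE]] := projY_spec f; exists h.
Qed.

Lemma tauY_projY f : eshift E xi (tauY E Y xi f) + projY E Y xi f = f.
Proof. by rewrite (tauY_spec f).2 subrK. Qed.

Lemma regular_unique h y h' y' : dom E h -> dom E h' -> Y y -> Y y' ->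
  eshift E xi h + y = eshift E xi h' + y' -> h = h' /\ y = y'.
Proof.
move=> Eh Eh' Yy Yy' eqn.
have eq_diff : eshift E xi (h - h') = y' - y.
  rewrite (eshiftB E_linear) //; apply/eqP; by rewrite subr_eq addrAC (addrC y') -eqn addrK.
have y0 : y' - y = 0.
  have : (rngE E xi `&` Y) (y' - y).
    split; last exact: subspaceB.
    by exists (h - h') => //; exact: subspaceB.
  by rewrite xi_regular.2.2.
split; last by apply/esym/eqP; rewrite -subr_eq0 y0.
apply/eqP; rewrite -subr_eq0; apply/eqP/xi_inj; last by rewrite eq_diff.
exact: subspaceB.
Qed.

(** Uniqueness of the decomposition lets [tauY] and [projY] be computed by exhibiting any admissible
    pair. *)
Lemma regularE f h y : dom E h -> Y y -> eshift E xi h + y = f ->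
  tauY E Y xi f = h /\ projY E Y xi f = y.
Proof.
move=> Eh Yy hy; apply: regular_unique => //; last by rewrite tauY_projY.
- exact: (tauY_spec f).1.
- exact: (projY_spec f).1.
Qed.

Lemma regular_linear a f g :
  tauY E Y xi (a *: f + g) = a *: tauY E Y xi f + tauY E Y xi g /\
  projY E Y xi (a *: f + g) = a *: projY E Y xi f + projY E Y xi g.
Proof.
apply: regularE.
- by apply: E_dom.2; exact: (tauY_spec _).1.
- by apply: Y_sub.2; exact: (projY_spec _).1.
- rewrite (eshiftP E_linear) //; try exact: (tauY_spec _).1.
  by rewrite addrACA -scalerDr !tauY_projY.
Qed.

Lemma tauY_linear : linear (tauY E Y xi).
Proof. by move=> a f g; exact: (regular_linear a f g).1. Qed.

Lemma projY_linear : linear (projY E Y xi).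
Proof. by move=> a f g; exact: (regular_linear a f g).2. Qed.

(** A closed graph argument: [zabreiko] is applied to the sum [N] of the norms of the two
    components. For a series with bounded [N]-sums both component series converge absolutely, and
    closedness of [E] and [Y] identifies their limits as the components of the sum. *)
Lemma regular_bound : exists2 c : R, 0 < c & forall h y, dom E h -> Y y ->
  nrm h + nrm y <= c * nrm (eshift E xi h + y).
Proof.
pose N f : R := nrm (tauY E Y xi f) + nrm (projY E Y xi f).
suff [c c0 cN] : exists2 c : R, 0 < c & forall f, N f <= c * nrm f.
  exists c => // h y Eh Yy; have := cN (eshift E xi h + y).
  by rewrite /N; have [-> ->] := regularE Eh Yy (erefl _).
apply: zabreiko => [f g|r f|u f M uf uM].
- rewrite /N -[f]scale1r tauY_linear projY_linear !scale1r.
  have := ler_rnormD (tauY E Y xi f) (tauY E Y xi g).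
  have := ler_rnormD (projY E Y xi f) (projY E Y xi g); lra.
- rewrite /N -[_ *: f]addr0 tauY_linear projY_linear.
  have [-> ->] : tauY E Y xi 0 = 0 /\ projY E Y xi 0 = 0.
    apply: regularE; [exact: subspace0|exact: subspace0|].
    by rewrite (eshift0 E_linear) addr0.
  by rewrite !addr0 !rnormZr mulrDr.
pose H n := \sum_(k < n) tauY E Y xi (u k).
pose Z n := \sum_(k < n) projY E Y xi (u k).
have HZ n : [/\ dom E (H n), Y (Z n),
    eshift E xi (H n) + Z n = \sum_(k < n) u k & nrm (H n) + nrm (Z n) <= M].
  suff [h1 h2 h3 h4] : [/\ dom E (H n), Y (Z n), eshift E xi (H n) + Z n = \sum_(k < n) u k
      & nrm (H n) + nrm (Z n) <= \sum_(k < n) N (u k)].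
    by split=> //; apply: le_trans (uM n).
  rewrite /H /Z; elim: n => [|n [h1 h2 h3 h4]].
    rewrite !big_ord0 rnorm0 addr0 (eshift0 E_linear) addr0.
    by split=> //; exact: subspace0.
  have [Et tE] := tauY_spec (u n); have [Yp _] := projY_spec (u n).
  rewrite !big_ord_recr /=; split; [exact: subspaceD|exact: subspaceD| |].
    rewrite -[X in eshift _ _ (X + _)]scale1r (eshiftP E_linear) // scale1r.
    by rewrite addrACA h3 tauY_projY.
  have := ler_rnormD (\sum_(k < n) tauY E Y xi (u k)) (tauY E Y xi (u n)).
  have := ler_rnormD (\sum_(k < n) projY E Y xi (u k)) (projY E Y xi (u n)).
  by rewrite [N (u n)]/N; lra.
have [|h Hh] := @summable_limit _ _ (fun k => tauY E Y xi (u k)) M.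
  move=> n; apply: le_trans (uM n); apply: ler_sum => k _.
  by rewrite /N lerDl rnorm_ge0.
have [|z Zz] := @summable_limit _ _ (fun k => projY E Y xi (u k)) M.
  move=> n; apply: le_trans (uM n); apply: ler_sum => k _.
  by rewrite /N lerDr rnorm_ge0.
have close e : 0 < e -> exists n, [/\ nrm (H n - h) < e, nrm (Z n - z) < e &
    nrm (\sum_(k < n) u k - f) < e].
  move=> e0; have [n1 hn1] := Hh e e0; have [n2 hn2] := Zz e e0; have [n3 hn3] := uf e e0.
  exists (maxn n1 (maxn n2 n3)); split.
  - by apply: hn1; exact: leq_maxl.
  - by apply: hn2; rewrite !leq_max leqnn orbT.
  - by apply: hn3; rewrite !leq_max leqnn !orbT.
have Yz : Y z.
  apply: closedP Y_closed.2 _ => e /close[n [_ Zn _]]; exists (Z n); rewrite 1?rnormC //.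
  by have [] := HZ n.
have [Eh hE] : dom E h /\ f - z + xi *: h = act E h.
  apply: closed_opP => // e e0.
  (* The error in [act E (H n)] has two terms below [d] and one, multiplied by [xi], below or equal
     to [rnorm xi * d]; together they stay below [e]. *)
  have c0 : 0 < rnorm xi + 3 by rewrite ltr_wpDl // rnorm_ge0.
  have [n [Hn Zn un]] := close _ (divr_gt0 e0 c0).
  have [En _ /eqP] := HZ n; rewrite eq_sym -subr_eq => /eqP nE _.
  set d := e / _ in Hn Zn un.
  have d0 : 0 < d by rewrite divr_gt0.
  have de : e = d * (rnorm xi + 3) by rewrite divfK // gt_eqF.
  have x0 := rnorm_ge0 xi.
  exists (H n); split=> //; first by rewrite rnormC; nra.
  rewrite -[act E (H n)](subrK (xi *: H n)) -/(eshift E xi (H n)) -nE.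
  have -> : f - z + xi *: h - (\sum_(k < n) u k - Z n + xi *: H n) =
      - (\sum_(k < n) u k - f) + ((Z n - z) - xi *: (H n - h)).
    rewrite scalerBr !opprB opprD opprB addrACA [RHS]addrA; congr (_ + _).
    by rewrite (addrC (Z n)) addrACA (addrC (- z)).
  apply: le_lt_trans (ler_rnormD _ _) _; rewrite rnormN.
  have := ler_rnormD (Z n - z) (- (xi *: (H n - h))).
  by rewrite rnormN rnormZ; nra.
rewrite /N; have [-> ->] : tauY E Y xi f = h /\ projY E Y xi f = z.
  apply: regularE => //; by rewrite /eshift -hE addrK subrK.
apply/ler_addgt0Pr => e e0.
have e2 : 0 < e / 2 by rewrite divr_gt0.
have [n [Hn Zn _]] := close _ e2.
have [_ _ _] := HZ n.
have := ler_rnormB h (H n) 0; have := ler_rnormB z (Z n) 0.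
rewrite !subr0 (rnormC h) (rnormC z); lra.
Qed.
End Point.

(** * Dependence of the decomposition on the spectral parameter *)

Section Family.
Variable Omega : set C.
Hypotheses (Omega_regular : forall xi, Omega xi -> regular_point E Y xi)
  (Omega_inj : forall xi h, Omega xi -> dom E h -> eshift E xi h = 0 -> h = 0).

(** The decompositions of [g] at [xi] and [lambda] differ by one of [- ((lambda - xi) *: h)] at
    [xi]. The bound at [xi] thus controls the difference once [h] is bounded uniformly in
    [lambda]. *)
Lemma projY_continuous xi g (e : R) : Omega xi -> 0 < e ->
  exists2 d : R, 0 < d & forall lambda, Omega lambda -> rnorm (lambda - xi) < d ->
    nrm (projY E Y xi g - projY E Y lambda g) < e.
Proof.
move=> Oxi e0.
have [c c0 cb] := regular_bound (Omega_regular Oxi) (fun h => @Omega_inj xi h Oxi).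
have g1 : 0 < nrm g + 1 by rewrite ltr_wpDl // rnorm_ge0.
have g0 : 0 <= nrm g := rnorm_ge0 _.
(* The first bound absorbs [c * t * nrm h] into half of [nrm h], giving [nrm h <= 2 * c * nrm g];
   the second makes the resulting estimate smaller than [e]. *)
pose d := Num.min (2 * c)^-1 (e / (2 * c ^+ 2 * (nrm g + 1))).
exists d => [|lambda Ol].
  by rewrite lt_min invr_gt0 divr_gt0 ?mulr_gt0 ?exprn_gt0.
rewrite lt_min ltr_pdivlMr ?mulr_gt0 ?exprn_gt0 //.
rewrite -[(2 * c)^-1]mul1r ltr_pdivlMr ?mulr_gt0 //.
set t := rnorm (lambda - xi) => /andP[d1 d2].
have t0 : 0 <= t := rnorm_ge0 _.
have [El _] := tauY_spec (Omega_regular Ol) g.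
have [Ex _] := tauY_spec (Omega_regular Oxi) g.
have [Yl _] := projY_spec (Omega_regular Ol) g.
have [Yx _] := projY_spec (Omega_regular Oxi) g.
have lE := tauY_projY (Omega_regular Ol) g.
have xE := tauY_projY (Omega_regular Oxi) g.
set h := tauY E Y lambda g in El lE; set y := projY E Y lambda g in Yl lE *.
set h' := tauY E Y xi g in Ex xE; set y' := projY E Y xi g in Yx xE *.
have e1 : eshift E xi h + y = g + (lambda - xi) *: h.
  by rewrite (eshift_shift E lambda) addrAC lE.
have e2 : eshift E xi (h' - h) + (y' - y) = - ((lambda - xi) *: h).
  rewrite (eshiftB E_linear) // addrACA -opprD e1 xE opprD addrA subrr.
  by rewrite add0r.
have b1 := cb _ _ El Yl; have b2 := cb _ _ (subspaceB E_dom Ex El) (subspaceB Y_sub Yx Yl).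
rewrite e1 in b1; rewrite e2 rnormN rnormZ -/t in b2.
have b3 := ler_rnormD g ((lambda - xi) *: h); rewrite rnormZ -/t in b3.
have h0 : 0 <= nrm h := rnorm_ge0 _.
have y0 : 0 <= nrm y := rnorm_ge0 _.
have hy0 : 0 <= nrm (h' - h) := rnorm_ge0 _.
have b4 : nrm h <= 2 * c * nrm g.
  have : c * nrm (g + (lambda - xi) *: h) <= c * (nrm g + t * nrm h) by rewrite ler_pM2l.
  have : t * (2 * c) * nrm h <= nrm h by rewrite ler_piMl // ltW.
  lra.
have b5 : c * (t * nrm h) <= c * t * (2 * c * nrm g).
  by rewrite mulrA ler_wpM2l // mulr_ge0 // ltW.
have b6 : c * t * (2 * c * nrm g) <= t * (2 * c ^+ 2 * (nrm g + 1)).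
  have : 0 <= t * c ^+ 2 by rewrite mulr_ge0 // sqr_ge0.
  lra.
lra.
Qed.
End Family.
End Regular.

(** * The model *)

Section Model.
Variables (R : realType) (X : completeNormedModType R[i]).
Local Notation C := R[i].
Variables (ip : {dot X for Num.conj}) (E : operator X) (Y : set X) (Omega : set C).
Hypotheses (ip_hilbert : hilbert_product ip) (E_linear : linear_op E)
  (E_closed : closed_op E) (E_symmetric : symmetric_op ip E)
  (E_simple : simple_op ip E) (Y_closed : closed_subspace Y)
  (Omega_open : open (Omega : set C^o))
  (Omega_symmetric : forall xi, Omega xi -> Omega xi^*)
  (Omega_regular : forall xi, Omega xi -> regular_point E Y xi)
  (Omega_nonreal : nonreal_part Omega !=set0).

Local Notation fY := (fY E Y Omega).
Local Notation projY := (projY E Y).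
Local Notation tauY := (tauY E Y).

Let E_dom : subspace (dom E) := E_linear.1.
Let Omega_closed xi (Oxi : Omega xi) : closed (rngE E xi) := (Omega_regular Oxi).1.
Let inj xi h : dom E h -> eshift E xi h = 0 -> h = 0.
Proof.
exact: (eshift_injective ip_hilbert E_linear E_symmetric Omega_open Omega_symmetric).
Qed.

Let range_eq0 f : common_range E Omega f -> f = 0.
Proof.
exact: (common_range_eq0 ip_hilbert E_linear E_symmetric Omega_open Omega_symmetric).
Qed.

Lemma on_OmegaE (V : zmodType) (g : C -> V) xi : Omega xi -> on_Omega Omega g xi = g xi.
Proof. by move=> Oxi; rewrite /on_Omega patchE mem_set. Qed.

Lemma on_Omega_out (V : zmodType) (g : C -> V) xi : ~ Omega xi -> on_Omega Omega g xi = 0.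
Proof. by move=> nOxi; rewrite /on_Omega patchE memNset. Qed.

Lemma on_Omega_eq (V : zmodType) (g h : C -> V) :
  (forall xi, Omega xi -> g xi = h xi) -> on_Omega Omega g = on_Omega Omega h.
Proof.
move=> gh; apply/funext => xi; have [Oxi|nOxi] := pselect (Omega xi).
  by rewrite !on_OmegaE // gh.
by rewrite !on_Omega_out.
Qed.

Lemma on_Omega_linear (V : lmodType C) (u : X -> C -> V) :
  (forall xi, Omega xi -> linear (u^~ xi)) -> linear (fun f => on_Omega Omega (u f)).
Proof.
move=> u_lin a f g; apply/funext => xi; rewrite fctE; have [Oxi|nOxi] := pselect (Omega xi).
  by rewrite fctE !on_OmegaE // u_lin.
by rewrite fctE !on_Omega_out // scaler0 addr0.
Qed.

Lemma fY_linear : linear fY.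
Proof.
apply: on_Omega_linear => xi Oxi.
exact: (projY_linear E_linear Y_closed (Omega_regular Oxi) (@inj xi)).
Qed.

(** Where the projections of [f] and [g] agree, [f - g] lies in the range; hence it lies in
    [common_range], which is zero. *)
Lemma fY_inj : injective fY.
Proof.
move=> f g fg; apply/eqP; rewrite -subr_eq0; apply/eqP/range_eq0 => xi [Oxi _].
have := congr1 (@^~ xi) fg; rewrite /fY !on_OmegaE // => pfg.
have -> : f - g = (f - projY xi f) - (g - projY xi g).
  by rewrite pfg (opprB g) addrA subrK.
apply: subspaceB; first exact: rngE_subspace.
- exact: (projY_spec (Omega_regular Oxi) f).2.
- exact: (projY_spec (Omega_regular Oxi) g).2.
Qed.

Lemma push_formE (W : Type) c (u : X -> W) f g : injective u ->
  push_form ip c u (u f) (u g) = c * ip f g.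
Proof.
move=> u_inj; rewrite /push_form.
have pre k : xget 0 [set h | u h = u k] = k.
  by apply: u_inj; exact: (xgetPex 0 (P := [set h | u h = u k]) (ex_intro _ k (erefl _))).
by rewrite !pre.
Qed.

Lemma mul_fY f : dom E f -> (fun lambda => lambda *: fY f lambda) = fY (act E f).
Proof.
move=> Ef; apply/funext => xi; rewrite /fY; have [Oxi|nOxi] := pselect (Omega xi); last first.
  by rewrite !on_Omega_out // scaler0.
rewrite !on_OmegaE // -[act E f](subrK (xi *: f)) addrC.
have reg := Omega_regular Oxi.
rewrite (projY_linear E_linear Y_closed reg (@inj xi)).
have [_ ->] := regularE E_linear Y_closed reg (@inj xi) Ef (subspace0 Y_closed.1) (addr0 _).
by rewrite addr0.
Qed.

(** The equation says that [projY lambda] kills [g - lambda *: f], so [tauY] gives exact preimages.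
    By [resolvent_common_range] they differ from [f] by an element of the zero space [common_range],
    so [f] is one of them. *)
Lemma mul_fY_dom f g : (fun lambda => lambda *: fY f lambda) = fY g -> dom E f.
Proof.
move=> fg.
have tP lambda : nonreal_part Omega lambda ->
    dom E (tauY lambda (g - lambda *: f)) /\
    eshift E lambda (tauY lambda (g - lambda *: f)) = g - lambda *: f.
  move=> [Ol _]; have reg := Omega_regular Ol.
  have [Et tE] := tauY_spec reg (g - lambda *: f); split=> //; rewrite tE.
  have := congr1 (@^~ lambda) fg; rewrite /fY !on_OmegaE // => pfg.
  rewrite [in projY _ _]addrC -scaleNr (projY_linear E_linear Y_closed reg (@inj lambda)).
  by rewrite -pfg !scaleNr addNr subr0 addrC.
have [xi Oxi] := Omega_nonreal.
have := resolvent_common_range ip_hilbert E_linear E_symmetric Omega_open Omega_closed tP Oxi.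
by move=> /range_eq0/eqP; rewrite subr_eq0 => /eqP <-; exact: (tP _ Oxi).1.
Qed.

(** Apply [projY lambda] to the decomposition of [f] at [xi], after rewriting the shift at [xi] as
    the shift at [lambda] plus a multiple of [tauY xi f]. It kills the shifted part and fixes
    [projY xi f]. *)
Lemma projY_shift f xi lambda : Omega xi -> Omega lambda ->
  projY lambda f - projY xi f = (lambda - xi) *: projY lambda (tauY xi f).
Proof.
move=> Oxi Ol; have [regx regl] := (Omega_regular Oxi, Omega_regular Ol).
have [Et _] := tauY_spec regx f; have [Yp _] := projY_spec regx f.
rewrite -{1}(tauY_projY regx f) (eshift_shift E lambda) (addrC (eshift _ _ _)) -addrA.
rewrite (projY_linear E_linear Y_closed regl (@inj lambda)).
have [_ ->] := regularE E_linear Y_closed regl (@inj lambda) Et Yp (erefl _).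
by rewrite addrK.
Qed.

(** By [projY_shift] the difference quotient equals [projY (h + xi) (tauY xi f)], so continuity of
    the projection gives the limit. *)
Lemma derive1_fY f xi : Omega xi -> derive1 (fY f) xi = projY xi (tauY xi f).
Proof.
move=> Oxi; apply: cvg_lim => //; apply/cvgrPdist_lt => e /gt0_realC[r r0 ->].
have [d d0 dP] := projY_continuous E_linear E_closed Y_closed Omega_regular
  (fun xi h _ => @inj xi h) (tauY xi f) Oxi r0.
have : nbhs (xi : C^o) Omega by apply: open_nbhs_nbhs; split.
move=> /nbhs_ballP[e' /= /gt0_realC[d' d'0 ->] dO].
(* The radius [d'] keeps [h + xi] in [Omega], away from the default value 0 of [fY]. *)
pose m := Num.min d d'.
have m0 : 0 < m by rewrite lt_min d0.
apply/nbhs_ballP; exists m%:C%C; first by rewrite /= ltcR.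
move=> h; rewrite -ball_normE /ball_ /= sub0r normrN rnormE ltcR lt_min => /andP[hd hd'] h0.
have Oh : Omega (h + xi).
  by apply: dO; rewrite -ball_normE /ball_ /= opprD addrCA subrr addr0 normrN rnormE ltcR.
rewrite /fY !on_OmegaE // projY_shift // addrK scalerA mulVf // scale1r.
by rewrite rnormE ltcR; apply: dP => //; rewrite addrK.
Qed.

Lemma bshift_fY f xi : Omega xi -> bshift Omega xi (fY f) = fY (tauY xi f).
Proof.
move=> Oxi; apply: on_Omega_eq => lambda Ol.
case: eqVneq => [->|lx]; first exact: derive1_fY.
rewrite /fY !on_OmegaE // projY_shift // scalerA mulVf ?scale1r //.
by rewrite subr_eq0.
Qed.

Lemma xget_ip (v : X) (F : X -> C) : (forall l, ip v l = F l) ->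
  xget 0 [set v | forall l, ip v l = F l] = v.
Proof.
move=> vF; apply: (ip_ext (ip := ip)) => l; rewrite vF.
exact: (xgetPex 0 (P := [set v | forall l, ip v l = F l]) (ex_intro _ v vF)).
Qed.

Lemma Z1_fY f : Z1 ip E Y Omega (fY f) = tilde1 E Y Omega f.
Proof.
apply: on_Omega_eq => xi Oxi; apply: xget_ip => l.
by rewrite bshift_fY // /N_form push_formE ?mul1r ?ipZl //; exact: fY_inj.
Qed.

(** Self-adjointness moves the projection from [l] onto [tauY xi f]. *)
Lemma Z2_fY f : Z2 ip E Y Omega (fY f) = tilde2 ip E Y Omega f.
Proof.
apply: on_Omega_eq => xi Oxi; apply: xget_ip => l.
rewrite bshift_fY // /N_form push_formE ?mul1r ?ipZl ?oproj_selfadjoint //.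
exact: fY_inj.
Qed.

Lemma tilde1_linear : linear (tilde1 E Y Omega).
Proof.
apply: on_Omega_linear => xi Oxi a f g.
rewrite (tauY_linear E_linear Y_closed (Omega_regular Oxi) (@inj xi)).
by rewrite scalerDr !scalerA mulrC.
Qed.

Lemma tilde2_linear : linear (tilde2 ip E Y Omega).
Proof.
apply: on_Omega_linear => xi Oxi a f g.
rewrite (tauY_linear E_linear Y_closed (Omega_regular Oxi) (@inj xi)).
by rewrite (oproj_linear ip_hilbert Y_closed) scalerDr !scalerA mulrC.
Qed.

(** * The unitary map, for both models at once *)

Section Unitary.
Variables (tilde : X -> C -> X) (Z : (C -> X) -> C -> X).
Hypotheses (tilde_linear : linear tilde) (Z_fY : forall f, Z (fY f) = tilde f).

Let V (f : X) : C -> X * X := column (fY f) (tilde f).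
(* [c] compensates for the factor 2 in the inner product of the model space. *)
Let c : C := ((Num.sqrt 2)^-1 : R)%:C%C.
Let U (f : X) : C -> X * X := V (c *: f).

Let V_linear : linear V.
Proof.
move=> a f g; apply/funext => xi.
by rewrite /V /column fY_linear tilde_linear.
Qed.

Let U_linear : linear U.
Proof. by move=> a f g; rewrite /U -V_linear scalerDr !scalerA mulrC. Qed.

Lemma model_unitarily_equivalent :
  unitarily_equivalent ip E (range V) (push_form ip 2 V) (D_op E Y Omega Z).
Proof.
have sqrt2 : Num.sqrt 2 != 0 :> R by rewrite sqrtr_eq0 -ltNge.
have c0 : c != 0 by rewrite /c eq_complex /= invr_eq0 negb_and sqrt2.
have cJ : c^* = c by apply/eqP; rewrite eq_complex /= oppr0 !eqxx.
have cc : 2 * (c * c) = 1.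
  have two : 2 = 2%:C%C :> C by rewrite rmorph_nat.
  rewrite two /c -!rmorphM -invfM -expr2 sqr_sqrtr // mulfV //.
have cK f : c *: (c^-1 *: f) = f by rewrite scalerA mulfV // scale1r.
(* Homogeneity of [E] is that of its shift by 0. *)
have actZ f : dom E f -> act E (c *: f) = c *: act E f.
  by move=> Ef; have := eshiftZ E_linear 0 c Ef; rewrite /eshift !scale0r !subr0.
have V_inj : injective V.
  move=> f g /(congr1 (@fst_entry _ _)); exact: fY_inj.
pose UL : {linear X -> (C -> X * X)%type} := HB.pack U (GRing.isLinear.Build C X (C -> X * X)%type _ U U_linear).
have ULE f : UL f = V (c *: f) by [].
exists UL; split.
- apply/seteqP; split=> _ [f _ <-]; first by exists (c *: f).
  by exists (c^-1 *: f) => //; rewrite ULE cK.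
- move=> f g; rewrite !ULE push_formE // ipZl ipZr cJ.
  by rewrite (mulrA c) mulrA cc mul1r.
(* The forward inclusion is [mul_fY], which exhibits the product as an element of the space; the
   converse is [mul_fY_dom]. *)
- apply/seteqP; split=> [_ [f Ef <-]|_ [g [[f _ <-] [g' _ fg]] <-]].
    have Ecf : dom E (c *: f) by exact: subspaceZ.
    exists (fY (c *: f)); last by rewrite Z_fY ULE.
    by split; [exists (c *: f)|exists (act E (c *: f)); rewrite // -mul_fY].
  exists (c^-1 *: f); last by rewrite ULE cK Z_fY.
  by apply: subspaceZ => //; apply: mul_fY_dom (esym fg).
- move=> f Ef; have Ecf : dom E (c *: f) by exact: subspaceZ.
  rewrite !ULE /V /= -actZ // -[fst_entry _]/(fY (c *: f)).
  by rewrite mul_fY // Z_fY.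
Qed.
End Unitary.
End Model.

Theorem theorem3p12 (R : realType) (X : completeNormedModType R[i])
  (ip : {dot X for Num.conj}) (ip_hilbert : hilbert_product ip)
  (X_separable : separable X) (X_infinite : ~ finite_dim [set: X])
  (E : operator X) (E_linear : linear_op E) (E_closed : closed_op E)
  (E_dense : dense (dom E)) (E_symmetric : symmetric_op ip E)
  (E_simple : simple_op ip E)
  (E_deficiency : infinite_deficiency_indices ip E)
  (Y : set X) (Y_closed : closed_subspace Y) (Y_infinite : ~ finite_dim Y)
  (Omega : set R[i]) (Omega_nonempty : Omega !=set0) (Omega_open : open (Omega : set R[i]^o))
  (Omega_symmetric : forall xi, Omega xi -> Omega xi^*)
  (Omega_regular : forall xi, Omega xi -> regular_point E Y xi)
  (alpha_exists : exists alpha : R[i],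
     [/\ Omega alpha, upper_half alpha,
         (forall omega, Omega omega -> lower_half omega ->
            finite_dim (rngE E alpha `&` orth ip (rngE E omega)) /\
            closed (sumset (rngE E alpha) (orth ip (rngE E omega)))) &
         (forall omega, Omega omega -> upper_half omega ->
            finite_dim (rngE E alpha^* `&` orth ip (rngE E omega)) /\
            closed (sumset (rngE E alpha^*) (orth ip (rngE E omega))))]) :
  unitarily_equivalent ip E (H1_space E Y Omega) (H1_form ip E Y Omega)
    (D1_op ip E Y Omega) /\
  unitarily_equivalent ip E (H2_space ip E Y Omega) (H2_form ip E Y Omega)
    (D2_op ip E Y Omega).
Proof.
(* The point [alpha] of the open upper half plane is nonreal. *)
have Omega_nonreal : nonreal_part Omega !=set0.
  have [alpha [Oa a0 _ _]] := alpha_exists.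
  by exists alpha; split=> //; rewrite gt_eqF.
split; apply: model_unitarily_equivalent => //.
- exact: tilde1_linear.
- exact: Z1_fY.
- exact: tilde2_linear.
- exact: Z2_fY.
Qed.
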